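(* For every clause-set $F$ we have $\mathrm{rs}(F) \le 3\,\mathrm{ss}(F) - 2$, where $\mathrm{rs}$ denotes resolution-space complexity and $\mathrm{ss}$ denotes semantic-space complexity (both extended to all clause-sets as described in the context).
   Context: Literals are variables $v$ or negated variables $\overline{v}$; a clause is a finite set of literals without a complementary pair; a clause-set is a finite set of clauses. $\bot$ is the empty clause, $\top$ the empty clause-set; $c(F)$ is the number of clauses of $F$. A partial assignment $\varphi$ is a map from a finite set of variables to $\{0,1\}$; $\varphi * F$ is obtained by removing all clauses containing a literal made true by $\varphi$ and removing all literals made false from the remaining clauses. $F$ is satisfiable if $\varphi*F=\top$ for some $\varphi$, otherwise unsatisfiable. $F \models G$ means every partial assignment $\varphi$ with $\varphi*F=\top$ also satisfies $\varphi*G=\top$. Two clauses $C,D$ are resolvable if $C\cap\overline{D}=\{x\}$ for exactly one literal $x$ (where $\overline{D}$ is the set of complements of literals of $D$); their resolvent is $(C\cup D)\setminus\{x,\overline{x}\}$. Semantic $k$-sequence for $F$ ($k\ge 1$): a sequence $F_1,\dots,F_p$ of clause-sets with $c(F_i)\le k$ for all $i$, $F_1=\top$, and for each $i\ge 2$ either $F_{i-1}\models F_i$ (inference) or $F_i=F_{i-1}\cup\{C\}$ for some $C\in F$ (axiom download). It is complete if $F_p$ is unsatisfiable. For unsatisfiable $F$, $\mathrm{ss}(F)$ is the least $k$ admitting a complete semantic $k$-sequence. Resolution $k$-sequence for $F$: as a semantic $k$-sequence, but each non-download step satisfies $F_i \subseteq F_{i-1}\cup\{R\}$ where either $R$ is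 a resolvent of two clauses of $F_{i-1}$ or no clause is added (removal of clauses and/or addition of one resolvent). It is complete if $\bot\in F_p$; for unsatisfiable $F$, $\mathrm{rs}(F)$ is the least $k$ admitting a complete resolution $k$-sequence. Extension to all clause-sets: for a measure $\mu$ on unsatisfiable clause-sets, set $\mu(\top):=\min\{\mu(G): G \text{ unsatisfiable}\}$, and for $F\ne\top$ set $\mu(F):=\max\{\mu(\varphi*F): \varphi \text{ a partial assignment with } \varphi*F \text{ unsatisfiable}\}$. *)

(* Defs.v *)
From HB Require Import structures.
From mathcomp Require Import all_boot all_order all_algebra.
From mathcomp Require Import finmap.
From mathcomp Require Import boolp classical_sets.

Set Implicit Arguments.
Unset Strict Implicit.
Unset Printing Implicit Defensive.

Local Open Scope fset_scope.
Local Open Scope fmap_scope.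

(* (v, true) is the literal v, (v, false) its negation. *)
Notation literal V := (V * bool)%type.

Definition compl (V : choiceType) (x : literal V) : literal V := (x.1, ~~ x.2).

Definition compl_set (V : choiceType) (A : {fset literal V}) : {fset literal V} :=
  [fset compl x | x in A].

Definition clash_free (V : choiceType) (A : {fset literal V}) : bool :=
  A `&` compl_set A == fset0.

Record clause (V : choiceType) :=
  Clause { lits : {fset literal V}; lits_clash_free : clash_free lits }.

HB.instance Definition _ (V : choiceType) := [isSub for @lits V].
HB.instance Definition _ (V : choiceType) := [Choice of clause V by <:].

Notation clauseset V := {fset clause V}.

Lemma clash_free_sub (V : choiceType) (A B : {fset literal V}) :
  A `<=` B -> clash_free B -> clash_free A.
Proof.
move=> sAB /eqP B0; rewrite /clash_free -fsubset0 -B0.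
apply: fsetISS => //; apply/fsubsetP => y /imfsetP[x xA ->].
by apply: in_imfset; apply: (fsubsetP sAB).
Qed.

Lemma clash_free0 (V : choiceType) : clash_free (fset0 : {fset literal V}).
Proof. by rewrite /clash_free fset0I. Qed.

Definition bot (V : choiceType) : clause V := Clause (clash_free0 V).
Arguments bot {V}.

Definition pass (V : choiceType) := {fmap V -> bool}.

Definition lit_true (V : choiceType) (phi : pass V) (x : literal V) : bool :=
  phi.[? x.1] == Some x.2.

Definition lit_false (V : choiceType) (phi : pass V) (x : literal V) : bool :=
  phi.[? x.1] == Some (~~ x.2).

Definition restrict_lits (V : choiceType) (phi : pass V) (A : {fset literal V}) :
  {fset literal V} := [fset x in A | ~~ lit_false phi x].

Lemma restrict_lits_clash_free (V : choiceType) (phi : pass V) (C : clause V) :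
  clash_free (restrict_lits phi (lits C)).
Proof. exact: clash_free_sub (fset_sub _ _) (lits_clash_free C). Qed.

Definition restrict_clause (V : choiceType) (phi : pass V) (C : clause V) : clause V :=
  Clause (restrict_lits_clash_free phi C).

Definition clause_true (V : choiceType) (phi : pass V) (C : clause V) : bool :=
  [exists x : lits C, lit_true phi (val x)].

(* phi * F *)
Definition apply_pass (V : choiceType) (phi : pass V) (F : clauseset V) : clauseset V :=
  [fset restrict_clause phi C | C in F & ~~ clause_true phi C].

(* The clause-set with no clauses (top) is fset0. *)
Definition satisfiable (V : choiceType) (F : clauseset V) : Prop :=
  exists phi : pass V, apply_pass phi F = fset0.

Definition unsat (V : choiceType) (F : clauseset V) : Prop := ~ satisfiable F.

Definition entails (V : choiceType) (F G : clauseset V) : Prop :=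
  forall phi : pass V, apply_pass phi F = fset0 -> apply_pass phi G = fset0.

(* R is the resolvent of C and D. A relation rather than an operation because
   it is defined only for resolvable C, D; (C `|` D) minus the clashing pair is
   then clash-free, so asking R to be a clause is no restriction. *)
Definition is_resolvent (V : choiceType) (C D R : clause V) : Prop :=
  exists2 x : literal V,
    lits C `&` compl_set (lits D) = [fset x] &
    lits R = (lits C `|` lits D) `\` [fset x; compl x].

Definition download (V : choiceType) (F G G' : clauseset V) : Prop :=
  exists2 C : clause V, C \in F & G' = G `|` [fset C].

Definition semantic_step (V : choiceType) (F G G' : clauseset V) : Prop :=
  entails G G' \/ download F G G'.

Definition resolution_step (V : choiceType) (F G G' : clauseset V) : Prop :=
  [\/ G' `<=` G,
      (exists C D R : clause V,
         [/\ C \in G, D \in G, is_resolvent C D R & G' `<=` G `|` [fset R]])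
    | download F G G'].

(* s = [:: F_1; ...; F_p], so that F_i is nth fset0 s i.-1. *)
Definition k_sequence (V : choiceType)
    (step : clauseset V -> clauseset V -> Prop) (k : nat) (s : seq (clauseset V)) : Prop :=
  [/\ (0 < size s)%N,
      (forall G, G \in s -> (#|` G| <= k)%N),
      nth fset0 s 0 = fset0 &
      forall i, (i.+1 < size s)%N -> step (nth fset0 s i) (nth fset0 s i.+1)].

Definition complete_semantic (V : choiceType) (k : nat) (F : clauseset V)
    (s : seq (clauseset V)) : Prop :=
  k_sequence (semantic_step F) k s /\ unsat (last fset0 s).

Definition complete_resolution (V : choiceType) (k : nat) (F : clauseset V)
    (s : seq (clauseset V)) : Prop :=
  k_sequence (resolution_step F) k s /\ bot \in last fset0 s.

(* Both return 0 when there is no least / greatest element. *)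
Definition least (P : nat -> Prop) : nat :=
  [get k : nat | P k /\ forall j, P j -> (k <= j)%N].

Definition greatest (P : nat -> Prop) : nat :=
  [get k : nat | P k /\ forall j, P j -> (j <= k)%N].

(* For unsatisfiable F; a complete sequence then exists for some k (by
   downloading all of F, and by refutation-completeness of resolution). *)
Definition ss_unsat (V : choiceType) (F : clauseset V) : nat :=
  least (fun k => (1 <= k)%N /\ exists s, complete_semantic k F s).

Definition rs_unsat (V : choiceType) (F : clauseset V) : nat :=
  least (fun k => (1 <= k)%N /\ exists s, complete_resolution k F s).

(* Minimum and maximum are over nonempty sets: [fset bot] is unsatisfiable, and
   falsifying one clause of F <> top makes it unsatisfiable. The maximum is over
   a finite set of values since F has finitely many restrictions. On an
   unsatisfiable F both measures are unchanged, as they do not increase under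
   partial assignments. *)
Definition extend (V : choiceType) (mu : clauseset V -> nat) (F : clauseset V) : nat :=
  if F == fset0
  then least (fun m => exists2 G : clauseset V, unsat G & m = mu G)
  else greatest (fun m => exists2 phi : pass V,
                   unsat (apply_pass phi F) & m = mu (apply_pass phi F)).

Definition ss (V : choiceType) (F : clauseset V) : nat := extend (@ss_unsat V) F.

Definition rs (V : choiceType) (F : clauseset V) : nat := extend (@rs_unsat V) F.

(* Main.v *)
Require Import Defs.
From mathcomp Require Import all_boot all_order all_algebra.
From mathcomp Require Import finmap zify.
From mathcomp Require Import boolp classical_sets.

(** A semantic [k]-sequence is simulated by resolution, keeping at most one
    subsuming clause per clause of the current configuration.  For an inference
    step, each new clause [D] has to be derived from a set of at most [k]
    clauses entailing it.  Choosing a minimal entailing subset, some literal [x]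
    outside [D] occurs in it with both signs, so each of the two branches
    [D, x] and [D, ~ x] is already entailed by one clause less.  By induction
    [k - 1] clauses of working space suffice, which with the [k] premises and
    the at most [k - 1] clauses already derived makes [3 k - 2]. *)

Set Implicit Arguments.
Unset Strict Implicit.
Unset Printing Implicit Defensive.

Local Open Scope fset_scope.

(** * Entailment over total assignments *)

Section Semantics.
Variable V : choiceType.
Implicit Types (x : literal V) (C D : clause V) (F G H : clauseset V).
Implicit Types (a : V -> bool) (phi : pass V).

(** Semantic arguments evaluate clauses under total assignments; [pass_of] cuts these down to finite
    domains to link them with partial assignments. *)
Definition satisfies a C : Prop := exists2 x, x \in lits C & a x.1 = x.2.

Definition models a F : Prop := forall C, C \in F -> satisfies a C.

Definition implicate H D : Prop := forall a, models a H -> satisfies a D.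

Lemma complK : involutive (@compl V).
Proof. by case=> v b; rewrite /compl /= negbK. Qed.

Lemma mem_compl_set (A : {fset literal V}) x : (x \in compl_set A) = (compl x \in A).
Proof.
apply/imfsetP/idP => [[y /= yA ->]|xA]; first by rewrite complK.
by exists (compl x); rewrite ?complK.
Qed.

Lemma compl_neq x : compl x != x.
Proof. by case: x => v b; rewrite /compl xpair_eqE /= eqxx; case: b. Qed.

Lemma same_var x y : x.1 = y.1 -> y = x \/ y = compl x.
Proof. by case: x y => [v b] [w c] /= <-; case: b; case: c; [left|right|right|left]. Qed.

Lemma clash_freeP (A : {fset literal V}) :
  reflect (forall x, x \in A -> compl x \notin A) (clash_free A).
Proof.
apply: (iffP eqP) => [A0 x xA|AP].
  apply/negP => cxA; have : x \in A `&` compl_set A by rewrite inE xA mem_compl_set.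
  by rewrite A0 inE.
apply/eqP; rewrite -fsubset0; apply/fsubsetP => x.
by rewrite inE mem_compl_set => /andP[/AP /negPf ->].
Qed.

Lemma lits_compl C x : x \in lits C -> compl x \notin lits C.
Proof. by move: x; apply/clash_freeP/lits_clash_free. Qed.

Lemma clause_trueP phi C :
  reflect (exists2 x, x \in lits C & lit_true phi x) (clause_true phi C).
Proof.
apply: (iffP existsP) => [[x tx]|[x xC tx]]; first by exists (val x); rewrite ?fsvalP.
by exists [` xC]%fset.
Qed.

Lemma apply_pass_eq0 phi F :
  apply_pass phi F = fset0 <-> forall C, C \in F -> clause_true phi C.
Proof.
split=> [F0 C CF|FT].
  apply: contrapT => /negP nC; have : restrict_clause phi C \in apply_pass phi F.
    by apply/imfsetP; exists C => //=; rewrite !inE CF.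
  by rewrite F0 inE.
apply/eqP; rewrite -fsubset0; apply/fsubsetP => D /imfsetP[C /=].
by rewrite !inE => /andP[/FT ->].
Qed.

Definition vars F : {fset V} := [fset x.1 | C in F, x in lits C].

Definition pass_of (W : {fset V}) a : pass V := [fmap v : W => a (val v)].

Lemma pass_ofE (W : {fset V}) a v :
  (pass_of W a).[? v]%fmap = if v \in W then Some (a v) else None.
Proof.
by case: fndP => [vW|/negPf] /=; rewrite ?ffunE ?vW //=.
Qed.

Lemma models_pass_of F a : models a F -> apply_pass (pass_of (vars F) a) F = fset0.
Proof.
move=> aF; apply/apply_pass_eq0 => C CF; have [x xC ax] := aF C CF.
apply/clause_trueP; exists x => //; rewrite /lit_true pass_ofE ax ifT //.
by apply/imfset2P; exists C => //; exists x.
Qed.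

Lemma unsat_implicate F D : unsat F -> implicate F D.
Proof. by move=> uF a /models_pass_of aF; case: uF; exists (pass_of (vars F) a). Qed.

Lemma entails_implicate F G D : entails F G -> D \in G -> implicate F D.
Proof.
move=> FG DG a /models_pass_of /FG /apply_pass_eq0 /(_ _ DG) /clause_trueP [x xD].
by rewrite /lit_true pass_ofE; case: ifP => // _ /eqP [ax]; exists x.
Qed.

(** The simulation invariant: the resolution configuration [G] may hold stronger clauses than the
    semantic configuration [F]. *)
Definition subsumes G F : Prop :=
  forall C, C \in F -> exists2 C', C' \in G & lits C' `<=` lits C.

Lemma models_subsumes a G F : subsumes G F -> models a G -> models a F.
Proof.
move=> GF aG C /GF [C' /aG [x xC' ax] /fsubsetP sC].
by exists x => //; apply: sC.
Qed.

(** Since [D] has no complementary pair, this makes every literal of [D] false. *)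
Definition falsifier D (v : V) : bool := (v, false) \in lits D.

Lemma falsifierP D x : x \in lits D -> falsifier D x.1 = ~~ x.2.
Proof.
case: x => v [] xD; rewrite /falsifier //=.
by apply/negbTE/(lits_compl xD).
Qed.

Lemma falsifierN D : ~ satisfies (falsifier D) D.
Proof. by case=> x /falsifierP -> ; case: x.2. Qed.

Lemma implicate_nonempty H D : implicate H D -> exists C, C \in H.
Proof.
move=> HD; apply: contrapT => H0; apply: (@falsifierN D); apply: HD => C CH.
by case: H0; exists C.
Qed.

Lemma unsat_nonempty F : unsat F -> exists C, C \in F.
Proof. by move=> /(@unsat_implicate _ bot)/implicate_nonempty. Qed.

Definition extendable D x : bool := (x \notin lits D) && (compl x \notin lits D).

Lemma clash_free_extend D x : extendable D x -> clash_free (x |` lits D).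
Proof.
case/andP=> xD cxD; apply/clash_freeP => y /fset1UP[->|yD]; rewrite !inE negb_or.
  by rewrite compl_neq.
rewrite (lits_compl yD) andbT; apply: contraNN cxD => /eqP <-.
by rewrite complK.
Qed.

Definition extend_clause D x (ext : extendable D x) : clause V :=
  Clause (clash_free_extend ext).

Lemma extendable_compl D x : extendable D x -> extendable D (compl x).
Proof. by rewrite /extendable complK andbC. Qed.

Lemma implicate_branch H C D x (ext : extendable D x) :
    implicate H D -> C \in H -> compl x \in lits C ->
  implicate (H `\ C) (extend_clause ext).
Proof.
move=> HD CH cxC a aH; case: (pselect (a x.1 = x.2)) => [ax|/eqP nax].
  by exists x => //=; rewrite !inE eqxx.
have [|y yD ay] := HD a; last by exists y; rewrite //= !inE yD orbT.
move=> C' C'H; have [->|nC] := eqVneq C' C; last by apply: aH; rewrite !inE nC.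
by exists (compl x) => //=; move: nax; case: (a _) x.2 => [] [].
Qed.

(** Here [x] is pure in [H]: flipping the variable to make [x] true satisfies [C], harms no other
    clause of [H], and does not affect [D], where the variable is absent. *)
Lemma implicate_irrelevant H C D x :
    implicate H D -> x \in lits C -> extendable D x ->
    (forall C', C' \in H -> compl x \notin lits C') ->
  implicate (H `\ C) D.
Proof.
move=> HD xC /andP[xD cxD] nx a aH.
pose b v := if v == x.1 then x.2 else a v.
have [|y yD] := HD b.
  move=> C' C'H; have [->|nC] := eqVneq C' C; first by exists x; rewrite /b ?eqxx.
  have [|y yC' ay] := aH C'; first by rewrite !inE nC.
  exists y => //; rewrite /b; case: eqP => // exy.
  case: (same_var (esym exy)) => [-> //|ey].
  by move: yC'; rewrite ey (negPf (nx _ C'H)).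
rewrite /b; case: eqP => [exy|_ ay]; last by exists y.
by case: (same_var (esym exy)) yD => ->; rewrite ?(negPf xD) ?(negPf cxD).
Qed.

Lemma implicate_satisfied H C D x :
  implicate H D -> x \in lits C -> compl x \in lits D -> implicate (H `\ C) D.
Proof.
move=> HD xC xD a aH; case: (pselect (a x.1 = x.2)) => [ax|/eqP nax].
  apply: HD => C' C'H; have [->|nC] := eqVneq C' C; first by exists x.
  by apply: aH; rewrite !inE nC.
by exists (compl x) => //=; move: nax; case: (a _) x.2 => [] [].
Qed.

End Semantics.

(** * Space-bounded derivations and the simulation *)

Section Resolution.
Variables (V : choiceType) (F : clauseset V).
Implicit Types (x : literal V) (A B C D : clause V) (G H M : clauseset V).

Inductive derivation (k : nat) M : clauseset V -> Prop :=
| derivation_refl : derivation k M M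
| derivation_step G G' : derivation k M G -> resolution_step F G G' ->
    #|` G'| <= k -> derivation k M G'.

Lemma derivation_trans k G M H :
  derivation k M G -> derivation k G H -> derivation k M H.
Proof. by move=> MG; elim=> // G1 G2 _ MG1 st sz; apply: derivation_step MG1 st sz. Qed.

Lemma derivation_sub k M G G' :
  derivation k M G -> G' `<=` G -> #|` G'| <= k -> derivation k M G'.
Proof. by move=> MG GG' sz; apply: (derivation_step MG) => //; constructor 1. Qed.

Lemma cardfsU1_le (T : choiceType) (a : T) (E : {fset T}) : #|` a |` E| <= #|` E|.+1.
Proof. by rewrite cardfsU1; case: (_ \notin _). Qed.

(** A clash between [A] and [B] other than on [x] would be a complementary pair inside [D]. *)
Lemma resolvent_sub A B D x :
    extendable D x -> x \in lits A -> compl x \in lits B ->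
    lits A `<=` x |` lits D -> lits B `<=` compl x |` lits D ->
  exists2 R, is_resolvent A B R & lits R `<=` lits D.
Proof.
move=> ext xA cxB /fsubsetP sA /fsubsetP sB; have /andP[xD cxD] := ext.
have sR : (lits A `|` lits B) `\` [fset x; compl x] `<=` lits D.
  apply/fsubsetP => y; rewrite !inE negb_or => /andP[/andP[/negPf nx /negPf ncx]].
  by case/orP=> [/sA|/sB]; rewrite !inE ?nx ?ncx.
exists (Clause (clash_free_sub sR (lits_clash_free D))) => //.
exists x => //; apply/fsetP => y; rewrite !inE mem_compl_set.
apply/andP/eqP => [[yA cyB]|-> //].
case/fset1UP: (sA _ yA) => // yD; case/fset1UP: (sB _ cyB) => [e|cyD].
  by rewrite -[y]complK e complK.
by move: (lits_compl yD); rewrite cyD.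
Qed.

Lemma fsub1U_notin (T : choiceType) (a : T) (E E' : {fset T}) :
  E `<=` a |` E' -> a \notin E -> E `<=` E'.
Proof.
move=> /fsubsetP sE aE; apply/fsubsetP => y yE.
by case/fset1UP: (sE _ yE) => // ya; rewrite -ya yE in aE.
Qed.

(** [M] stays in memory throughout, and [n] counts the extra working space, one less than the
    allowed number of premises. Induction on [n]: each branch loses a premise, and the clause of the
    first branch is stored while the second one is derived. *)
Lemma implicate_derivation k n H M D :
    H `<=` M -> #|` H| <= n.+1 -> implicate H D -> #|` M| + n <= k ->
  exists2 D', lits D' `<=` lits D & derivation k M (D' |` M).
Proof.
elim: n H M D => [|n IHn] H M D sHM szH HD szM.
  have [C CH] := implicate_nonempty HD.
  (* [H] has a single clause, and the empty set of premises implies no clause. *)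
  have nilH C1 D1 : C1 \in H -> ~ implicate (H `\ C1) D1.
    move=> C1H /implicate_nonempty [C2 C2H].
    have := cardfsD1 C1 H; rewrite C1H => e.
    have := cardfsD1 C2 (H `\ C1); rewrite C2H => e'.
    by move: szH; rewrite e e'.
  have [sCD|/fsubsetPn[x xC xD]] := boolP (lits C `<=` lits D).
    exists C => //; rewrite (fsetUidPr _ _ _) ?fsub1set ?(fsubsetP sHM) //.
    exact: derivation_refl.
  exfalso; have [cxD|cxD] := boolP (compl x \in lits D).
    exact: nilH CH (implicate_satisfied HD xC cxD).
  have ext : extendable D (compl x) by rewrite /extendable complK xD cxD.
  by apply: nilH CH (implicate_branch ext HD CH _); rewrite complK.
have szD C : C \in H -> #|` H `\ C| <= n.+1.
  by move=> CH; have := cardfsD1 C H; rewrite CH => e; rewrite e in szH.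
have sDM C : H `\ C `<=` M := fsubset_trans (fsubsetDl _ _) sHM.
have szMn : #|` M| + n <= k by lia.
case: (pselect (exists2 C, C \in H & implicate (H `\ C) D)) => [[C CH HCD]|minH].
  exact: IHn (sDM C) (szD C CH) HCD szMn.
have [C CH] := implicate_nonempty HD.
have [sCD|/fsubsetPn[x xC xD]] := boolP (lits C `<=` lits D).
  exists C => //; rewrite (fsetUidPr _ _ _) ?fsub1set ?(fsubsetP sHM) //.
  exact: derivation_refl.
have cxD : compl x \notin lits D.
  by apply/negP => cxD; apply: minH; exists C => //; apply: implicate_satisfied HD xC cxD.
have ext : extendable D x by rewrite /extendable xD cxD.
(* By minimality [x] is not pure in [H]. *)
have [C' C'H cxC'] : exists2 C', C' \in H & compl x \in lits C'.
  apply: contrapT => nC'; apply: minH; exists C => //.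
  apply: implicate_irrelevant HD xC ext _ => C' C'H; apply/negP => cxC'.
  by apply: nC'; exists C'.
have [A /= sA derA] :=
  IHn _ _ _ (sDM C') (szD _ C'H) (implicate_branch ext HD C'H cxC') szMn.
have [xA|xA] := boolP (x \in lits A); last first.
  by exists A => //; apply: fsub1U_notin sA xA.
have HB : implicate (H `\ C) (extend_clause (extendable_compl ext)).
  by apply: implicate_branch => //; rewrite complK.
have szMA := cardfsU1_le A M.
(* Keeping [A] costs one unit, paid for by the drop from [n.+1] to [n]. *)
have [B /= sB derB] :
  exists2 B, lits B `<=` compl x |` lits D & derivation k (A |` M) (B |` (A |` M)).
  apply: IHn (szD _ CH) HB _; last by lia.
  exact: fsubset_trans (sDM C) (fsubsetUr _ _).
have derAB := derivation_trans derA derB.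
have [xB|xB] := boolP (compl x \in lits B); last first.
  exists B; first exact: fsub1U_notin sB xB.
  apply: derivation_sub derAB _ _; first by rewrite fsetUS // fsubsetUr.
  by have := cardfsU1_le B M; lia.
have [R resR sR] := resolvent_sub ext xA xB sA sB.
(* One step adds the resolvent and discards [A] and [B], so three extra clauses never coexist. *)
exists R => //; apply: derivation_step derAB _ _; last by have := cardfsU1_le R M; lia.
constructor 2; exists A, B, R; split=> //; first by rewrite !inE eqxx orbT.
  by rewrite !inE eqxx.
by rewrite fsetUC fsetSU // fsetUA fsubsetUr.
Qed.

(** When a clause is derived, memory holds at most [k] clauses of [G] and [k - 1] earlier results;
    the derivation adds [k - 1], which gives [3 * k - 2]. *)
Lemma inference_derivation k G (s : seq (clause V)) :
    0 < k -> #|` G| <= k -> size s <= k ->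
    (forall D, D \in s -> implicate G D) ->
  exists G', [/\ #|` G'| <= size s,
                 forall D, D \in s -> exists2 D', D' \in G' & lits D' `<=` lits D &
                 derivation (3 * k - 2) G (G `|` G')].
Proof.
move=> k0 szG; elim: s => [_ _|D s IHs szs sG].
  by exists fset0; rewrite cardfs0 fsetU0; split=> //; apply: derivation_refl.
move: szs => /= szs.
have [||G' [szG' G's derG']] := IHs; first by lia.
  by move=> E Es; apply: sG; rewrite inE Es orbT.
have szU : #|` G `|` G'| <= #|` G| + #|` G'| by rewrite cardfsU leq_subr.
have [||||D' sD' derD'] := @implicate_derivation (3 * k - 2) k.-1 G (G `|` G') D.
- exact: fsubsetUl.
- by lia.
- by apply: sG; rewrite inE eqxx.
- by lia.
exists (D' |` G'); split.
- by apply: leq_trans (cardfsU1_le _ _) _; rewrite ltnS.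
- move=> E; rewrite inE => /orP[/eqP->|/G's [E' E'G' sE]].
    by exists D'; rewrite // !inE eqxx.
  by exists E'; rewrite // !inE E'G' orbT.
- by rewrite fsetUCA; apply: derivation_trans derG' derD'.
Qed.

Lemma semantic_simulation k s i :
    0 < k -> k_sequence (semantic_step F) k s -> i < size s ->
  exists G, [/\ #|` G| <= #|` nth fset0 s i|, subsumes G (nth fset0 s i) &
                derivation (3 * k - 2) fset0 G].
Proof.
move=> k0 [_ szs s0 steps]; elim: i => [_|i IHi lti].
  by exists fset0; split; rewrite ?s0 //; apply: derivation_refl.
have [G [szG subG derG]] := IHi (ltnW lti).
have ski j : j < size s -> #|` nth fset0 s j| <= k by move=> ?; apply/szs/mem_nth.
have szk := ski _ lti; have szGk : #|` G| <= k := leq_trans szG (ski _ (ltnW lti)).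
case: (steps i lti) => [ent|[C CF eC]].
  have [|G' [szG' subG' derG']] :=
    @inference_derivation k G (enum_fset (nth fset0 s i.+1)) k0 szGk szk.
    move=> D DF a aG; apply: (entails_implicate ent DF).
    exact: models_subsumes subG aG.
  exists G'; split=> //; apply: derivation_sub (derivation_trans derG derG') _ _.
    exact: fsubsetUr.
  by have : #|` G'| <= k := leq_trans szG' szk; lia.
(* If [C] is already present, the semantic configuration does not grow, and adding [C] to [G] could
   break the size invariant; so [G] is kept. *)
have [CF'|CF'] := boolP (C \in nth fset0 s i).
  by exists G; rewrite eC fsetUC (fsetUidPr _ _ _) ?fsub1set.
have szC : #|` nth fset0 s i.+1| = #|` nth fset0 s i|.+1.
  by rewrite eC fsetUC cardfsU1 CF'.
have szGC : #|` G `|` [fset C]| <= #|` nth fset0 s i.+1|.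
  by rewrite szC fsetUC; have := cardfsU1_le C G; lia.
exists (G `|` [fset C]); split=> //.
  move=> D; rewrite eC !inE => /orP[/subG [D' D'G sD]|/eqP->].
    by exists D'; rewrite // !inE D'G.
  by exists C; rewrite // !inE eqxx orbT.
apply: derivation_step derG _ _; last by lia.
by constructor 3; exists C.
Qed.

Lemma derivation_sequence k G : derivation k fset0 G ->
  exists2 s, k_sequence (resolution_step F) k s & last fset0 s = G.
Proof.
elim=> [|G1 G2 _ [s [s_gt0 szs s0 steps] lasts] st szG2].
  exists [:: fset0] => //; split=> // G'.
  by rewrite inE => /eqP->; rewrite cardfs0.
exists (rcons s G2); last by rewrite last_rcons.
split=> [|G'||i]; first by rewrite size_rcons.
- by rewrite mem_rcons inE => /orP[/eqP->|/szs].
- by rewrite nth_rcons s_gt0.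
rewrite size_rcons ltnS => lti; rewrite !nth_rcons lti.
case: ltnP => [/steps //|les].
have ei : i.+1 = size s by apply/eqP; rewrite eqn_leq lti les.
by rewrite ei eqxx (_ : i = (size s).-1) ?nth_last ?lasts // -ei.
Qed.

Lemma complete_semantic_resolution k s : complete_semantic k F s ->
  0 < k /\ exists t, complete_resolution (3 * k - 2) F t.
Proof.
move=> [ks us]; have [s_gt0 szs _ _] := ks.
have szl : #|` last fset0 s| <= k.
  by apply: szs; rewrite -nth_last mem_nth // prednK.
have [C Cs] := unsat_nonempty us.
have k0 : 0 < k.
  by apply: leq_trans szl; rewrite cardfs_gt0; apply/fset0Pn; exists C.
split=> //; have [|G] := @semantic_simulation k s (size s).-1 k0 ks.
  by rewrite prednK.
rewrite nth_last => -[szG subG derG].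
(* The last configuration is unsatisfiable but may lack [bot]; deriving it takes space [2 * k - 1],
   within the bound as [k] is positive. *)
have [||||D sD derD] := @implicate_derivation (3 * k - 2) k.-1 G G bot.
- by [].
- by lia.
- by move=> a /(models_subsumes subG); apply: unsat_implicate.
- by lia.
have eD : D = bot by apply: val_inj; apply/eqP; rewrite -fsubset0.
have [t kt lt] := derivation_sequence (derivation_trans derG derD).
by exists t; split=> //; rewrite lt eD !inE eqxx.
Qed.

(** Supplies a complete semantic sequence for unsatisfiable [F], so that [ss_unsat F] is a true
    minimum and at most the size of [F]. *)
Lemma download_all (s : seq (clause V)) : {subset s <= F} ->
  exists2 t, k_sequence (semantic_step F) #|` F| t & last fset0 t = [fset C in s].
Proof.
elim: s => [_|C s IHs sF].
  exists [:: fset0]; last by apply/fsetP => x; rewrite !inE.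
  by split=> // G'; rewrite inE => /eqP->; rewrite cardfs0.
have [|t [t_gt0 szt t0 steps] lastt] := IHs.
  by move=> E Es; apply: sF; rewrite inE Es orbT.
exists (rcons t [fset E in C :: s]); last by rewrite last_rcons.
split=> [|G'||i]; first by rewrite size_rcons.
- rewrite mem_rcons inE => /orP[/eqP->|/szt //].
  by apply/fsubset_leq_card/fsubsetP => E; rewrite !inE; apply: sF.
- by rewrite nth_rcons t_gt0.
rewrite size_rcons ltnS => lti; rewrite !nth_rcons lti.
case: ltnP => [/steps //|les].
have ei : i.+1 = size t by apply/eqP; rewrite eqn_leq lti les.
rewrite ei eqxx (_ : i = (size t).-1) ?nth_last ?lastt; last by rewrite -ei.
right; exists C; first by apply: sF; rewrite inE eqxx.
by apply/fsetP => E; rewrite !inE orbC.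
Qed.

End Resolution.

(** * Comparison of the measures and their extensions *)

Section Measures.
Variable V : choiceType.
Implicit Types F G : clauseset V.

Lemma leastP (P : nat -> Prop) k :
  P k -> P (least P) /\ forall j, P j -> least P <= j.
Proof.
move=> Pk; have exP : exists n, `[< P n >] by exists k; apply/asboolP.
rewrite /least; case: xgetP => [m _ [Pm mP]|/(_ (ex_minn exP)) []]; first by split.
case: ex_minnP => m /asboolP Pm mP; split=> // j Pj.
by apply: mP; apply/asboolP.
Qed.

Lemma greatestP (P : nat -> Prop) b k :
    P k -> (forall j, P j -> j <= b) ->
  P (greatest P) /\ forall j, P j -> j <= greatest P.
Proof.
move=> Pk Pb; have exP : exists n, `[< P n >] by exists k; apply/asboolP.
have bP n : `[< P n >] -> n <= b by move=> /asboolP /Pb.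
rewrite /greatest; case: xgetP => [m _ [Pm mP]|/(_ (ex_maxn exP bP)) []].
  by split.
case: ex_maxnP => m /asboolP Pm mP; split=> // j Pj.
by apply: mP; apply/asboolP.
Qed.

Lemma unsat_card_gt0 F : unsat F -> 0 < #|` F|.
Proof.
by move=> /unsat_nonempty[C CF]; rewrite cardfs_gt0; apply/fset0Pn; exists C.
Qed.

Lemma complete_semantic_card F : unsat F -> exists s, complete_semantic #|` F| F s.
Proof.
move=> uF; have [t kt lt] := @download_all V F (enum_fset F) (fun=> id).
exists t; split=> //; suff -> : last fset0 t = F by [].
by rewrite lt; apply/fsetP => C; rewrite !inE.
Qed.

Lemma ss_unsatP F : unsat F ->
  [/\ 0 < ss_unsat F, exists s, complete_semantic (ss_unsat F) F s &
      ss_unsat F <= #|` F|].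
Proof.
move=> uF; have witness := conj (unsat_card_gt0 uF) (complete_semantic_card uF).
have [[ss_gt0 exs] ssP] :=
  @leastP (fun k => 1 <= k /\ exists s, complete_semantic k F s) _ witness.
by split=> //; apply: ssP witness.
Qed.

Lemma rs_unsat_le F : unsat F -> rs_unsat F <= 3 * ss_unsat F - 2.
Proof.
move=> /ss_unsatP[ss_gt0 [s /complete_semantic_resolution[_ exr]] _].
have witness : 1 <= 3 * ss_unsat F - 2 /\
  exists t, complete_resolution (3 * ss_unsat F - 2) F t by split=> //; lia.
by have [_] := leastP
  (P := fun k => 1 <= k /\ exists s, complete_resolution k F s) witness; apply.
Qed.

(** Bounds [ss_unsat] uniformly over all unsatisfiable restrictions of [F], so the maximum defining
    [ss F] exists. *)
Lemma card_apply_pass phi F : #|` apply_pass phi F| <= #|` F|.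
Proof.
apply: leq_trans (leq_imfset_card imfset_key (restrict_clause phi) (mem F)).
apply/fsubset_leq_card/fsubsetP => D /imfsetP[C /=]; rewrite inE => /andP[CF _] ->.
by apply/imfsetP; exists C.
Qed.

Lemma unsat_mem_bot F : bot \in F -> unsat F.
Proof.
by move=> bF [phi /apply_pass_eq0 /(_ _ bF) /clause_trueP[x]]; rewrite inE.
Qed.

(** Falsifying all literals of one clause turns it into [bot]. *)
Lemma exists_unsat_apply_pass F : F != fset0 -> exists phi, unsat (apply_pass phi F).
Proof.
move=> /fset0Pn[C CF].
pose phi := pass_of [fset x.1 | x in lits C] (falsifier C).
have phiC x : x \in lits C -> phi.[? x.1]%fmap = Some (~~ x.2).
  move=> xC; rewrite pass_ofE (falsifierP xC) ifT //.
  by apply/imfsetP; exists x.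
exists phi; apply: unsat_mem_bot; apply/imfsetP; exists C => /=.
  rewrite !inE CF; apply/clause_trueP => -[x xC].
  by rewrite /lit_true phiC //; case: x.2.
apply: val_inj; apply/esym/eqP; rewrite -fsubset0; apply/fsubsetP => x.
by rewrite /= !inE => /andP[xC]; rewrite /lit_false phiC // eqxx.
Qed.

Lemma ss_top : exists2 G : clauseset V, unsat G & ss (fset0 : clauseset V) = ss_unsat G.
Proof.
rewrite /ss /extend eqxx.
pose P m := exists2 G : clauseset V, unsat G & m = ss_unsat G.
have Pbot : P (ss_unsat [fset @bot V]).
  by exists [fset bot] => //; apply: unsat_mem_bot; rewrite inE.
by have [[G uG eG] _] := leastP Pbot; exists G.
Qed.

Lemma ss_ge F phi : F != fset0 ->
  unsat (apply_pass phi F) -> ss_unsat (apply_pass phi F) <= ss F.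
Proof.
move=> /negPf F0 uF; rewrite /ss /extend F0.
pose P m := exists2 phi, unsat (apply_pass phi F) & m = ss_unsat (apply_pass phi F).
have Pphi : P (ss_unsat (apply_pass phi F)) by exists phi.
have [|_] := @greatestP P #|` F| _ Pphi; last exact.
move=> j [psi /ss_unsatP[_ _ lej] ->].
exact: leq_trans lej (card_apply_pass _ _).
Qed.

(** Positivity makes the truncated subtraction in [3 * ss F - 2] agree with the one over the
    integers. *)
Lemma ss_gt0 F : 0 < ss F.
Proof.
have [->|F0] := eqVneq F fset0.
  by have [G /ss_unsatP[ssG _ _] ->] := ss_top.
have [phi uF] := exists_unsat_apply_pass F0.
by have [ssF _ _] := ss_unsatP uF; apply: leq_trans ssF (ss_ge F0 uF).
Qed.

Lemma rs_le F : rs F <= 3 * ss F - 2.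
Proof.
have [->|F0] := eqVneq F fset0.
  have [G uG ->] := ss_top; apply: leq_trans (rs_unsat_le uG).
  rewrite /rs /extend eqxx.
  pose P m := exists2 G : clauseset V, unsat G & m = rs_unsat G.
  have PG : P (rs_unsat G) by exists G.
  by have [_] := leastP PG; apply.
rewrite /rs /extend (negPf F0) /greatest.
(* Either the maximum is attained at some [phi], or [rs F] is the default value 0. *)
case: xgetP => [m _ [[phi uF ->] _]|_] //.
by have := rs_unsat_le uF; have := ss_ge F0 uF; lia.
Qed.

End Measures.

Local Open Scope ring_scope.

Theorem theorem3p11 (V : choiceType) (F : {fset clause V}) :
  (rs F)%:Z <= 3 * (ss F)%:Z - 2.
Proof. by have := rs_le F; have := ss_gt0 F; lia. Qed.
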